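(* Let $q$ be a prime power, $K=\mathbb{F}_q((t^{-1}))$, $\mathcal{O}=\{f\in K:|f|\le 1\}$, $\mathbb{L}=\{f\in K:|f|<1\}$ and $\mathbb{J}_0=\{f\in\mathcal{O}:\deg(f)=0\}$. Let $\mu$ be the Haar measure on $K$ normalized so that $\mu(\mathcal{O})=1$, and define a measure $\mu_A$ on $\mathcal{O}$ by $$\mu_A(D)=\frac{q^2}{2q-1}\,\mu(D\cap\mathbb{L})+\frac{q}{2q-1}\,\mu(D\cap\mathbb{J}_0)$$ for each Borel set $D\subset\mathcal{O}$. Then, for each $h\in\mathbb{L}$ with $\deg(h)=-1$, the probability measure $\mu_A$ is an ergodic invariant measure for the algebraic Farey map $F_h:\mathcal{O}\to\mathcal{O}$ associated to $h$.
   Context: $K=\mathbb{F}_q((t^{-1}))$ is the field of formal Laurent series $f=a_nt^n+\dots+a_1t+a_0+a_{-1}t^{-1}+\cdots$ with $a_i\in\mathbb{F}_q$. For such $f$ with $a_n\ne 0$, $\deg(f)=n$ and $|f|=q^{n}$; by convention $\deg(0)=-\infty$ and $|0|=0$. The polynomial part of $f=\sum_{i\le n}a_it^i$ is $[f]=\sum_{0\le i\le n}a_it^i\in\mathbb{F}_q[t]$. For $h\in\mathbb{L}$ with $\deg(h)=-1$, the algebraic Farey map $F_h$ associated to $h$ is defined for nonzero $f\in\mathcal{O}$ by $$F_h(f)=\begin{cases}\dfrac{f}{1-[(1-h)f^{-1}]\,f}, & \deg(f)\le -1,\\[3mm] \dfrac{1-[(1-h)f^{-1}]\,f}{f}, &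 \deg(f)=0,\end{cases}$$ and $F_h(0)=0$ (the choice of value at the single point $0$, which is $\mu$-null, is immaterial). *)

(* Defs.v *)
From HB Require Import structures.
From mathcomp Require Import all_boot all_order all_algebra.
From mathcomp Require Import all_classical all_reals all_analysis.
From mathcomp Require Import zify ring lra.
Set Implicit Arguments.
Unset Strict Implicit.
Unset Printing Implicit Defensive.
Import Order.TTheory GRing.Theory Num.Theory.
Import numFieldNormedType.Exports.
Local Open Scope classical_set_scope.
Local Open Scope ring_scope.

(* Formal Laurent series in t^-1: [f n] is the coefficient of t^n, and only    *)
(* finitely many positive powers of t occur.                                  *)
Record laurent (F : fieldType) := Laurent {
  lcoef :> int -> F;
  lcoef_bounded : exists N : int, forall n, N < n -> lcoef n = 0 }.

HB.instance Definition _ (F : fieldType) := gen_eqMixin (laurent F).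
HB.instance Definition _ (F : fieldType) := gen_choiceMixin (laurent F).

Section laurent_field.
Variable F : fieldType.
Implicit Types f g h : laurent F.

Definition lbnd (N : int) (f : int -> F) := forall n, N < n -> f n = 0.

Lemma laurentP f g : f =1 g -> f = g.
Proof.
case: f g => [f fP] [g gP] /= /funext fg; subst g.
by congr Laurent; exact: Prop_irrelevance.
Qed.

Lemma lbnd_le M N (f : int -> F) : N <= M -> lbnd N f -> lbnd M f.
Proof. by move=> NM fN n /(le_lt_trans NM)/fN. Qed.

Lemma lbnd2 f g : exists2 N, lbnd N f & lbnd N g.
Proof.
have [N fN] := lcoef_bounded f; have [M gM] := lcoef_bounded g.
exists (Num.max N M); first by apply: lbnd_le fN; rewrite le_max lexx.
by apply: lbnd_le gM; rewrite le_max lexx orbT.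
Qed.

Lemma lzero_bounded : exists N : int, lbnd N (fun=> 0).
Proof. by exists 0. Qed.
Definition lzero := Laurent lzero_bounded.

Lemma lone_bounded : exists N : int, lbnd N (fun n => (n == 0)%:R).
Proof. by exists 0 => n; case: eqP => // ->; rewrite ltxx. Qed.
Definition lone := Laurent lone_bounded.

Lemma lopp_bounded f : exists N : int, lbnd N (fun n => - f n).
Proof.
have [N fN] := lcoef_bounded f.
by exists N => n /fN ->; rewrite oppr0.
Qed.
Definition lopp f := Laurent (lopp_bounded f).

Lemma ladd_bounded f g : exists N : int, lbnd N (fun n => f n + g n).
Proof.
have [N fN gN] := lbnd2 f g.
by exists N => n Nn; rewrite fN// gN// addr0.
Qed.
Definition ladd f g := Laurent (ladd_bounded f g).

(* Cauchy product; the sum has finite support. *)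
Definition lmul_coef f g (n : int) : F := \sum_(i \in [set: int]) f i * g (n - i).

Lemma lmul_coef0 N M f g : lbnd N f -> lbnd M g -> lbnd (N + M) (lmul_coef f g).
Proof.
move=> fN gM n Nn; rewrite /lmul_coef fsbig1// => i _.
have [/fN->|iN] := ltP N i; first by rewrite mul0r.
by rewrite gM ?mulr0//; lia.
Qed.

Lemma lmul_coefE N M f g (k : nat) : lbnd N f -> lbnd M g ->
  lmul_coef f g (N + M - k%:Z) =
    \sum_(i < k.+1) f (N - i%:Z) * g (M - (k - i)%N%:Z).
Proof.
move=> fN gM; rewrite /lmul_coef.
rewrite (reindex_fsbigT (fun i : int => N - i)); last first.
  by exists (fun i : int => N - i) => i; lia.
pose r := [seq (i : nat)%:Z | i <- iota 0 k.+1].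
rewrite (fsbigE r) //.
- rewrite big_map -[iota 0 k.+1]/(index_iota 0 k.+1) big_mkord.
  under eq_bigl do rewrite in_setT.
  by apply: eq_bigr => i _; congr (_ * g _); have := ltn_ord i; lia.
- by rewrite map_inj_uniq ?iota_uniq// => i j [].
- move=> i _ ir; have [i0|i0] := ltP i 0; first by rewrite fN ?mul0r//; lia.
  have [ik|ki] := leqP `|i|%N k; last by rewrite gM ?mulr0//; lia.
  by move: ir => /mapP[]; exists `|i|%N; [rewrite mem_iota; lia|lia].
Qed.

Lemma lmul_poly N M f g (P Q : {poly F}) (k : nat) : lbnd N f -> lbnd M g ->
  (forall i, (i <= k)%N -> P`_i = f (N - i%:Z)) ->
  (forall i, (i <= k)%N -> Q`_i = g (M - i%:Z)) ->
  lmul_coef f g (N + M - k%:Z) = (P * Q)`_k.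
Proof.
move=> fN gM Pf Qg; rewrite (lmul_coefE _ fN gM) coefM.
by apply: eq_bigr => i _; rewrite Pf ?Qg ?leq_subr// -ltnS.
Qed.

Lemma lmul_bounded f g : exists N : int, lbnd N (lmul_coef f g).
Proof.
have [N fN] := lcoef_bounded f; have [M gM] := lcoef_bounded g.
by exists (N + M); exact: lmul_coef0.
Qed.
Definition lmul f g := Laurent (lmul_bounded f g).

Definition ltrunc N f k := \poly_(i < k.+1) f (N - i%:Z).

Lemma coef_ltrunc N f k i : (i <= k)%N -> (ltrunc N f k)`_i = f (N - i%:Z).
Proof. by move=> ik; rewrite coef_poly ltnS ik. Qed.

Lemma lmulE N M f g k : lbnd N f -> lbnd M g ->
  lmul f g (N + M - k%:Z) = (ltrunc N f k * ltrunc M g k)`_k.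
Proof.
by move=> fN gM; apply: lmul_poly => // i ik; rewrite coef_ltrunc.
Qed.

Lemma lmul_truncE N M f g k i : lbnd N f -> lbnd M g -> (i <= k)%N ->
  (ltrunc N f k * ltrunc M g k)`_i = lmul f g (N + M - i%:Z).
Proof.
move=> fN gM ik; apply/esym/lmul_poly => // j ji.
  by rewrite coef_ltrunc// (leq_trans ji).
by rewrite coef_ltrunc// (leq_trans ji).
Qed.

Lemma lbnd_ext N f g : lbnd N f -> lbnd N g ->
  (forall k : nat, f (N - k%:Z) = g (N - k%:Z)) -> f = g.
Proof.
move=> fN gN fg; apply: laurentP => n.
have [Nn|nN] := ltP N n; first by rewrite fN// gN.
have -> : n = N - `|N - n|%N%:Z by lia.
exact: fg.
Qed.

Lemma lmulC : commutative lmul.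
Proof.
move=> f g; have [N fN] := lcoef_bounded f; have [M gM] := lcoef_bounded g.
apply: (@lbnd_ext (N + M)); first exact: lmul_coef0.
  by rewrite addrC; exact: lmul_coef0.
by move=> k; rewrite lmulE// mulrC (addrC N) lmulE.
Qed.

Lemma lmulA : associative lmul.
Proof.
move=> f g h; have [N fN] := lcoef_bounded f; have [M gM] := lcoef_bounded g.
have [L hL] := lcoef_bounded h.
have fgP : lbnd (N + M) (lmul f g) by exact: lmul_coef0.
have ghP : lbnd (M + L) (lmul g h) by exact: lmul_coef0.
apply: (@lbnd_ext (N + M + L)); last 1 first.
- move=> k; pose P := ltrunc N f k; pose Q := ltrunc M g k; pose S := ltrunc L h k.
  transitivity ((P * (Q * S))`_k).
    rewrite -(addrA N M L); apply: (@lmul_poly N (M + L) f (lmul g h)) => // i ik; first by rewrite coef_ltrunc.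
    by rewrite lmul_truncE.
  rewrite mulrA; apply/esym; apply: (@lmul_poly (N + M) L (lmul f g) h) => // i ik; last by rewrite coef_ltrunc.
  by rewrite lmul_truncE.
- by rewrite -addrA; apply: (@lmul_coef0 N (M + L) f (lmul g h)).
- exact: (@lmul_coef0 (N + M) L (lmul f g) h).
Qed.

Lemma lone_bnd : lbnd 0 lone.
Proof. by move=> n n0 /=; case: eqP n0 => // ->; rewrite ltxx. Qed.

Lemma lmul1 : left_id lone lmul.
Proof.
move=> f; have [N fN] := lcoef_bounded f.
apply: (@lbnd_ext N) => //.
  by rewrite -[N]add0r; apply: lmul_coef0 => //; exact: lone_bnd.
move=> k; rewrite -{1}[N]add0r -[LHS]/(lmul_coef lone f _).
rewrite (lmul_poly (P := 1) (Q := ltrunc N f k) lone_bnd fN).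
- by rewrite mul1r coef_ltrunc.
- by move=> i _; rewrite coef1 /=; congr (nat_of_bool _)%:R; lia.
- by move=> i ik; rewrite coef_ltrunc.
Qed.

Lemma lmulDl : left_distributive lmul ladd.
Proof.
move=> f g h; have [N fN gN] := lbnd2 f g; have [M hM] := lcoef_bounded h.
have fgN : lbnd N (ladd f g) by move=> n Nn /=; rewrite fN// gN// addr0.
have fhP : lbnd (N + M) (lmul f h) by exact: lmul_coef0.
have ghP : lbnd (N + M) (lmul g h) by exact: lmul_coef0.
apply: (@lbnd_ext (N + M)); first exact: lmul_coef0.
  by move=> n Nn; rewrite -[LHS]/(lmul f h n + lmul g h n) fhP// ghP// addr0.
move=> k; rewrite -[RHS]/(lmul f h _ + lmul g h _) !lmulE// -coefD -mulrDl.
suff -> : ltrunc N (ladd f g) k = ltrunc N f k + ltrunc N g k by [].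
by apply/polyP => i; rewrite coefD !coef_poly; case: ifP; rewrite ?addr0.
Qed.

Lemma laddA : associative ladd.
Proof. by move=> f g h; apply: laurentP => n /=; rewrite addrA. Qed.
Lemma laddC : commutative ladd.
Proof. by move=> f g; apply: laurentP => n /=; rewrite addrC. Qed.
Lemma ladd0 : left_id lzero ladd.
Proof. by move=> f; apply: laurentP => n /=; rewrite add0r. Qed.
Lemma laddN : left_inverse lzero lopp ladd.
Proof. by move=> f; apply: laurentP => n /=; rewrite addNr. Qed.

Lemma lone_neq0 : lone != lzero.
Proof.
apply/eqP => /(congr1 (fun f : laurent F => f 0)) /= /eqP.
by rewrite oner_eq0.
Qed.

Lemma ldegree_ex f : f <> lzero -> exists2 n, f n != 0 & lbnd n f.
Proof.
move=> f0; have [N fN] := lcoef_bounded f.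
have exk : exists k : nat, f (N - k%:Z) != 0.
  apply: contra_notP f0 => nk; apply: (@lbnd_ext N) => // k /=.
  by apply: contra_notP nk => fk; exists k; apply/eqP.
exists (N - (ex_minn exk)%:Z); case: ex_minnP => // k fk kmin n kn.
have [Nn|nN] := ltP N n; first exact: fN.
apply/eqP/negPn/negP => fn; have := kmin `|N - n|%N.
have -> : N - `|N - n|%N%:Z = n by lia.
by move=> /(_ fn); lia.
Qed.

(* Coefficients of the reciprocal of a power series with invertible constant  *)
(* term, computed one at a time.                                              *)
Fixpoint inv_coefs (a : nat -> F) (k : nat) : seq F :=
  if k is k'.+1 then
    rcons (inv_coefs a k')
      (- (a 0%N)^-1 * \sum_(i < k'.+1) a i.+1 * (inv_coefs a k')`_(k' - i))
  else [:: (a 0%N)^-1].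

Lemma size_inv_coefs a k : size (inv_coefs a k) = k.+1.
Proof. by elim: k => //= k IH; rewrite size_rcons IH. Qed.

Lemma nth_inv_coefs a k i : (i <= k)%N -> (inv_coefs a k)`_i = (inv_coefs a i)`_i.
Proof.
elim: k => [|k IH]; first by rewrite leqn0 => /eqP ->.
rewrite leq_eqVlt => /orP[/eqP -> //|]; rewrite ltnS => ik.
by rewrite /= nth_rcons size_inv_coefs ltnS ik IH.
Qed.

Lemma inv_coefsP a k : a 0%N != 0 ->
  \sum_(i < k.+1) a i * (inv_coefs a (k - i))`_(k - i) = (k == 0%N)%:R.
Proof.
move=> a0; rewrite big_ord_recl /= subn0; case: k => [|k].
  by rewrite big_ord0 addr0 /= divff.
rewrite [inv_coefs a k.+1]/= nth_rcons size_inv_coefs ltnn eqxx.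
rewrite mulrA mulrN divff// mulN1r; apply/eqP; rewrite addrC subr_eq0; apply/eqP.
by apply: eq_bigr => i _; rewrite /bump /= add1n subSS (@nth_inv_coefs a k) ?leq_subr.
Qed.

Lemma lmulV_ex f : f <> lzero -> exists g, lmul g f = lone.
Proof.
move=> /ldegree_ex[N fN0 fN].
pose a (i : nat) := f (N - i%:Z).
have a0 : a 0%N != 0 by rewrite /a subr0.
pose b (n : int) := if n <= - N then (inv_coefs a (absz (- N - n)))`_(absz (- N - n)) else 0.
have bP : lbnd (- N) b by move=> n Nn; rewrite /b leNgt Nn.
have bB : exists M : int, lbnd M b by exists (- N).
exists (Laurent bB); rewrite lmulC.
have gP : lbnd (- N) (Laurent bB) by [].
apply: (@lbnd_ext (N - N)); first exact: lmul_coef0.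
  by rewrite subrr; exact: lone_bnd.
move=> k; rewrite -[LHS]/(lmul_coef f (Laurent bB) _) (lmul_coefE _ fN gP) /=.
transitivity ((k == 0%N)%:R : F); last by congr (nat_of_bool _)%:R; lia.
rewrite -(inv_coefsP k a0); apply: eq_bigr => i _; congr (_ * _).
have ki : absz (- N - (- N - (k - i)%N%:Z))%R = (k - i)%N by lia.
by rewrite /b ki ifT//; lia.
Qed.

(* The inverse of [f] is characterised by its product with [f].               *)
Definition linv f : laurent F := xget lzero [set g | lmul g f = lone].

Lemma lmulV f : f != lzero -> lmul (linv f) f = lone.
Proof. by move=> /eqP/lmulV_ex fg; exact: (xgetPex lzero fg). Qed.

Lemma linv0 : linv lzero = lzero.
Proof.
apply: xgetPN => g /= g0; case/eqP: lone_neq0; rewrite -g0.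
apply: laurentP => n /=; rewrite /lmul_coef fsbig1// => i _ /=.
by rewrite mulr0.
Qed.

End laurent_field.

HB.instance Definition _ (F : fieldType) := GRing.isZmodule.Build (laurent F)
  (@laddA F) (@laddC F) (@ladd0 F) (@laddN F).
HB.instance Definition _ (F : fieldType) := GRing.Zmodule_isComNzRing.Build
  (laurent F) (@lmulA F) (@lmulC F) (@lmul1 F) (@lmulDl F) (@lone_neq0 F).
HB.instance Definition _ (F : fieldType) := GRing.ComNzRing_isField.Build
  (laurent F) (@lmulV F) (@linv0 F).
HB.instance Definition _ (F : fieldType) := isPointed.Build (laurent F) 0.

Section degree.
Variable F : fieldType.
Implicit Types f g : laurent F.

(* [-oo] when [f = 0]. *)
Definition ldeg f : \bar int :=
  xget -oo%E [set n%:E | n in [set n | f n != 0 /\ forall m, n < m -> f m = 0]].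
Arguments ldeg f%_R.

Lemma ldegP n f : f n != 0 -> (forall m, n < m -> f m = 0) -> ldeg f = n%:E.
Proof.
move=> fn fN; apply: xget_unique; first by exists n.
move=> _ [m [fm fM] <-]; congr EFin; apply: le_anti.
rewrite !leNgt; apply/andP; split; apply/negP.
  by move=> /fN /eqP; rewrite (negbTE fm).
by move=> /fM /eqP; rewrite (negbTE fn).
Qed.

Lemma ldeg0 : ldeg 0 = -oo%E.
Proof. by apply: xgetPN => x [n [/= n0]]; rewrite eqxx in n0. Qed.

Lemma ldegree_exists f : f != 0 ->
  exists n, [/\ ldeg f = n%:E, f n != 0 & forall m, n < m -> f m = 0].
Proof.
by move=> /eqP/ldegree_ex[n fn fN]; exists n; split=> //; exact: ldegP.
Qed.

Lemma ldeg_le f (n : int) : (ldeg f <= n%:E)%E <-> forall m, n < m -> f m = 0.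
Proof.
have [->|f0] := eqVneq f 0; first by rewrite ldeg0 leNye.
have [d [-> fd fD]] := ldegree_exists f0; rewrite lee_fin; split.
  by move=> dn m nm; rewrite fD// (le_lt_trans dn).
by move=> fn; rewrite leNgt; apply/negP => /fn /eqP; rewrite (negbTE fd).
Qed.

Lemma ldeg_lt f (n : int) : (ldeg f < n%:E)%E <-> forall m, n <= m -> f m = 0.
Proof.
have -> : (ldeg f < n%:E)%E = (ldeg f <= (n - 1)%:E)%E.
  by case: (ldeg f) => [d||]; rewrite ?lte_fin ?lee_fin ?ltNye ?leNye //; lia.
by rewrite ldeg_le; split=> fn m nm; apply: fn; lia.
Qed.

Definition lpoly_part_coef f (n : int) : F := if 0 <= n then f n else 0.

Lemma lpoly_part_bounded f :
  exists N : int, forall n, N < n -> lpoly_part_coef f n = 0.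
Proof.
have [N fN] := lcoef_bounded f; exists N => n /fN fn.
by rewrite /lpoly_part_coef fn if_same.
Qed.

(* The polynomial part, as an element of F[t] inside the field. *)
Definition lpoly_part f : laurent F := Laurent (lpoly_part_bounded f).

(* Degree balls are the balls of the absolute value |f| = q^deg(f): see       *)
(* [laurent_openP] below.                                                     *)
Definition laurent_open (U : set (laurent F)) :=
  forall f, U f -> exists n : int, forall g, (ldeg (g - f) < n%:E)%E -> U g.

Lemma laurent_openT : laurent_open setT.
Proof. by move=> f _; exists 0. Qed.

Lemma laurent_openI : setI_closed laurent_open.
Proof.
move=> U V Uo Vo f [/Uo[n Un] /Vo[m Vm]]; exists (Num.min n m) => g gf.
by split; [apply: Un|apply: Vm]; apply: (lt_le_trans gf);
  rewrite lee_fin ge_min lexx ?orbT.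
Qed.

Lemma laurent_open_bigU (I : Type) (U : I -> set (laurent F)) :
  (forall i, laurent_open (U i)) -> laurent_open (\bigcup_i U i).
Proof.
by move=> Uo f [i _ /Uo[n Un]]; exists n => g /Un ?; exists i.
Qed.

End degree.

HB.instance Definition _ (F : fieldType) := isOpenTopological.Build (laurent F)
  (@laurent_openT F) (@laurent_openI F) (@laurent_open_bigU F).

HB.instance Definition _ (F : fieldType) := @isMeasurable.Build
  (sigma_display (@open (laurent F))) (laurent F) <<s @open (laurent F) >>
  (@sigma_algebra0 _ setT (@open (laurent F))) (@sigma_algebraC _ (@open (laurent F)))
  (@sigma_algebra_bigcup _ setT (@open (laurent F))).

Section absolute_value.
Variables (R : realType) (F : finFieldType).
Implicit Types f g h : laurent F.
Local Notation q := (#|F|%:R : R).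

Definition labs f : R := if ldeg f is n%:E then q ^ n else 0.

Definition int_ring : set (laurent F) := [set f | labs f <= 1].
Definition max_ideal : set (laurent F) := [set f | labs f < 1].
Definition deg0_set : set (laurent F) := [set f | int_ring f /\ ldeg f = 0%:E].

Let q_gt1 : 1 < q.
Proof. by rewrite ltr1n card_finNzRing_gt1. Qed.

Lemma labs_lt f (n : int) : labs f < q ^ n <-> (ldeg f < n%:E)%E.
Proof.
have q0 : 0 < q := lt_trans ltr01 q_gt1.
have : ldeg f != +oo%E.
  by have [->|/ldegree_exists[d [-> //]]] := eqVneq f 0; rewrite ldeg0.
rewrite /labs; case: (ldeg f) => // [d|] _; last by rewrite exprz_gt0// ltNye.
by rewrite lte_fin ltr_eXz2l.
Qed.

Lemma labs_le f (n : int) : labs f <= q ^ n <-> (ldeg f <= n%:E)%E.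
Proof.
have q0 : 0 < q := lt_trans ltr01 q_gt1.
have : ldeg f != +oo%E.
  by have [->|/ldegree_exists[d [-> //]]] := eqVneq f 0; rewrite ldeg0.
rewrite /labs; case: (ldeg f) => // [d|] _.
  by rewrite lee_fin ler_eXz2l.
by rewrite leNye exprz_ge0// ltW.
Qed.

Lemma laurent_openP (U : set (laurent F)) : open U <->
  forall f, U f -> exists2 e : R, 0 < e & forall g, labs (g - f) < e -> U g.
Proof.
have q0 : 0 < q := lt_trans ltr01 q_gt1.
rewrite -[open U]/(laurent_open U); split=> Uo f Uf.
  have [n Un] := Uo f Uf; exists (q ^ n); first exact: exprz_gt0.
  by move=> g /labs_lt/Un.
have [e e0 Ue] := Uo f Uf; have [k ke] : exists k : nat, q ^ (- k%:Z) < e.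
  have [k /= ke] : exists k : nat, e^-1 < k%:R.
    by exists (Num.truncn e^-1).+1; rewrite truncnS_gt.
  exists k; rewrite -exprz_inv -[_ ^ _]/(_ ^+ _) exprVn.
  rewrite invf_plt ?posrE ?exprn_gt0//; apply: (lt_le_trans ke).
  by rewrite -natrX ler_nat ltnW// ltn_expl// card_finNzRing_gt1.
exists (- k%:Z) => g /labs_lt gf; apply: Ue; exact: lt_trans ke.
Qed.

Lemma int_ringE : int_ring = [set f | (ldeg f <= 0%:E)%E].
Proof. by apply/seteqP; split=> f; rewrite /int_ring /= -(labs_le f 0) expr0z. Qed.

Lemma max_idealE : max_ideal = [set f | (ldeg f < 0%:E)%E].
Proof. by apply/seteqP; split=> f; rewrite /max_ideal /= -(labs_lt f 0) expr0z. Qed.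

Lemma measurable_int_ring : measurable int_ring.
Proof.
apply: sub_sigma_algebra; rewrite int_ringE -[open _]/(laurent_open _) => f /ldeg_le f0.
exists 0 => g /ldeg_lt gf; apply/ldeg_le => m m0.
by rewrite -[g](subrK f) -[LHS]/((g - f) m + f m) gf ?f0 ?addr0// ltW.
Qed.

Lemma measurable_max_ideal : measurable max_ideal.
Proof.
apply: sub_sigma_algebra; rewrite max_idealE -[open _]/(laurent_open _) => f /ldeg_lt f0.
exists 0 => g /ldeg_lt gf; apply/ldeg_lt => m m0.
by rewrite -[g](subrK f) -[LHS]/((g - f) m + f m) gf ?f0 ?addr0.
Qed.

Lemma measurable_deg0_set : measurable deg0_set.
Proof.
have -> : deg0_set = int_ring `\` max_ideal.
  rewrite /deg0_set int_ringE max_idealE; apply/seteqP; split=> f /=.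
    by move=> [f0 ->]; rewrite ltxx lexx.
  by move=> [f0 /negP]; rewrite -leNgt => f1; split=> //; apply: le_anti; apply/andP.
by apply: measurableD; [exact: measurable_int_ring|exact: measurable_max_ideal].
Qed.

(* [K] is second countable and locally compact, so that regularity is implied. *)
Definition haar_measure (mu : {measure set (laurent F) -> \bar R}) :=
  [/\ forall (a : laurent F) (D : set (laurent F)), measurable D ->
        mu [set a + f | f in D] = mu D,
      forall C : set (laurent F), compact C -> (mu C < +oo)%E &
      exists2 D : set (laurent F), measurable D & mu D != 0%E].

Section mu_A.
Variable mu : {measure set (laurent F) -> \bar R}.

Definition mu_A (D : set (laurent F)) : \bar R :=
  ((q ^+ 2 / (2 * q - 1))%:E * mu (D `&` max_ideal) +
   (q / (2 * q - 1))%:E * mu (D `&` deg0_set))%E.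

Let c1_ge0 : 0 <= q ^+ 2 / (2 * q - 1).
Proof. by rewrite divr_ge0 ?sqr_ge0//; move: q_gt1; lra. Qed.
Let c2_ge0 : 0 <= q / (2 * q - 1).
Proof. by rewrite divr_ge0//; move: q_gt1; lra. Qed.

Let mu_AE : mu_A = measure_add
  (mscale (NngNum c1_ge0) (mrestr mu measurable_max_ideal))
  (mscale (NngNum c2_ge0) (mrestr mu measurable_deg0_set)).
Proof. by apply/funext => D; rewrite measure_addE. Qed.

Let mu_A0 : mu_A set0 = 0%E.
Proof. by rewrite mu_AE; exact: measure0. Qed.
Let mu_A_ge0 D : (0 <= mu_A D)%E.
Proof. by rewrite mu_AE; exact: measure_ge0. Qed.
Let mu_A_sigma_additive : semi_sigma_additive mu_A.
Proof. by rewrite mu_AE; exact: measure_semi_sigma_additive. Qed.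

HB.instance Definition _ := isMeasure.Build _ _ _ mu_A
  mu_A0 mu_A_ge0 mu_A_sigma_additive.

End mu_A.

End absolute_value.
Arguments int_ring : clear implicits.
Arguments max_ideal : clear implicits.
Arguments deg0_set : clear implicits.

(* The algebraic Farey map; only its values on deg(f) <= 0 matter.             *)
Definition farey (F : fieldType) (h f : laurent F) : laurent F :=
  if f == 0 then 0
  else if (ldeg f <= (-1)%:E)%E then f / (1 - lpoly_part ((1 - h) * f^-1) * f)
  else (1 - lpoly_part ((1 - h) * f^-1) * f) / f.

Section ergodicity.
Context d (T : measurableType d) (R : realType).
Variables (X : set T) (phi : T -> T) (m : {measure set T -> \bar R}).

(* [phi] is seen as a self-map of the measurable set [X], equipped with the   *)
(* trace sigma-algebra.                                                       *)
Definition invariant_measure_on :=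
  [/\ {homo phi : x / X x}, measurable_fun X phi &
      forall D, measurable D -> D `<=` X -> m (X `&` phi @^-1` D) = m D].

Definition ergodic_on :=
  forall D, measurable D -> D `<=` X -> X `&` phi @^-1` D = D ->
    m D = 0%E \/ m (X `\` D) = 0%E.

End ergodicity.

(* Main.v *)
(* In the coordinate g = 1/f the Farey map is the additive map
   S(g) = {g} + [h g]: it preserves the fractional part and, for deg g > 0,
   lowers the degree by one.  S is onto and the preimage of the open unit ball
   is the closed one, so S pushes Haar measure mu to q mu; inversion multiplies
   mu by q^(-2n) on the sphere of degree n.  Summing over spheres gives the
   invariance of mu_A.

   For ergodicity, iterating the Farey map takes f to {1/f}, so an invariant
   set D satisfies: f is in D iff {1/f} is in D.  Let A be the set of all g
   with {g} in D.  It is periodic under F_q[t], so it has the same proportion k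
   in all balls of radius at least that of the open unit ball.  Smaller balls
   are carried by inversion to larger ones, so the proportion is k in every
   ball; hence A is independent of every Borel set, in particular of its trace
   on the open unit ball, and k is 0 or 1. *)
Require Import Defs.
From mathcomp Require Import all_boot all_order all_algebra.
From mathcomp Require Import all_classical all_reals all_analysis.
From mathcomp Require Import zify ring lra.
Import Order.TTheory GRing.Theory Num.Theory.
Local Open Scope classical_set_scope.
Local Open Scope ring_scope.
Set Implicit Arguments.
Unset Strict Implicit.
Unset Printing Implicit Defensive.

(** * Degree conditions, ultrametric balls and spheres, inversion *)

Section small.
Variable F : fieldType.
Implicit Types (f g a b : laurent F) (r s n : int).

(** This is deg f < r, stated on coefficients to avoid the value -oo. With this strict bound
    [lball 0 0] is the open unit ball and [lball 0 1] is the closed one. *)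
Definition small r f := forall m, r <= m -> f m = 0.

Definition lball a r : set (laurent F) := [set f : laurent F | small r (f - a)].

Definition sphere n : set (laurent F) := [set f : laurent F | f n != 0 /\ small (n + 1) f].

Lemma ldeg_ltP f r : (ldeg f < r%:E)%E <-> small r f.
Proof. exact: ldeg_lt. Qed.

Lemma lcoefD f g m : (f + g) m = f m + g m. Proof. by []. Qed.
Lemma lcoefN f m : (- f) m = - f m. Proof. by []. Qed.
Lemma lcoefB f g m : (f - g) m = f m - g m. Proof. by []. Qed.
Lemma lcoef0 m : (0 : laurent F) m = 0. Proof. by []. Qed.
Lemma lcoef1 m : (1 : laurent F) m = (m == 0)%:R. Proof. by []. Qed.

Lemma small_le r s f : r <= s -> small r f -> small s f.
Proof. by move=> rs fr m sm; apply: fr; apply: le_trans sm. Qed.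

Lemma smallD r f g : small r f -> small r g -> small r (f + g).
Proof. by move=> fr gr m rm; rewrite lcoefD fr// gr// addr0. Qed.

Lemma smallN r f : small r f -> small r (- f).
Proof. by move=> fr m rm; rewrite lcoefN fr// oppr0. Qed.

Lemma smallB r f g : small r f -> small r g -> small r (f - g).
Proof. by move=> fr gr; apply: smallD => //; exact: smallN. Qed.

Lemma smallM r s f g : small r f -> small s g -> small (r + s - 1) (f * g).
Proof.
move=> fr gs m rsm; apply: (@lmul_coef0 F (r - 1) (s - 1)); last by lia.
- by move=> k rk; apply: fr; lia.
- by move=> k sk; apply: gs; lia.
Qed.

Lemma sphere_neq0 n f : sphere n f -> f != 0.
Proof. by case=> + _; apply: contra_neq => ->; rewrite lcoef0. Qed.

Lemma sphere_ex f : f != 0 -> exists n, sphere n f.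
Proof.
move=> /ldegree_exists[n [_ fn fN]]; exists n; split=> // m nm.
by apply: fN; lia.
Qed.

Lemma sphere_small n r f : sphere n f -> small r f <-> n < r.
Proof.
move=> [fn fS]; split=> [fr|nr]; last by apply: small_le fS; lia.
by rewrite ltNge; apply/negP => /fr; apply/eqP.
Qed.

Lemma sphere_inj n m f : sphere n f -> sphere m f -> n = m.
Proof.
move=> fn fm; have : small (n + 1) f by case: fn.
have : small (m + 1) f by case: fm.
rewrite (sphere_small _ fn) (sphere_small _ fm); lia.
Qed.

Lemma sphereE n f : sphere n f <-> small (n + 1) f /\ ~ small n f.
Proof.
split=> [fn|[f1 fn]].
  by split; [case: fn|rewrite (sphere_small _ fn) ltxx].
split=> //; apply/eqP => f0; apply: fn => m nm.
by have [->//|mn] := eqVneq m n; apply: f1; lia.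
Qed.

Lemma sphereD n f g : small n g -> sphere n f -> sphere n (f + g).
Proof.
move=> gn [fn f1]; split; first by rewrite lcoefD gn ?addr0.
by apply: smallD => //; apply: small_le gn; lia.
Qed.

Lemma sphere_ldeg n f : sphere n f <-> ldeg f = n%:E.
Proof.
split=> [[fn f1]|fn]; first by apply: ldegP => // m nm; apply: f1; lia.
have : f != 0 by apply: contra_eq_neq fn => ->; rewrite ldeg0.
move=> /ldegree_exists[d [fd f0 f1]]; move: fn; rewrite fd => -[<-].
by split=> // m dm; apply: f1; lia.
Qed.

Lemma sphereM n m f g : sphere n f -> sphere m g -> sphere (n + m) (f * g).
Proof.
move=> [fn f1] [gm g1]; split; last first.
  by have := smallM f1 g1; apply: small_le; lia.
have fN : lbnd n f by move=> k nk; apply: f1; lia.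
have gN : lbnd m g by move=> k nk; apply: g1; lia.
rewrite -[(f * g) _]/(lmul_coef f g (n + m)) -[n + m]subr0.
(* The top coefficient of the Cauchy product is the product of the two leading coefficients. *)
rewrite (@lmul_coefE F n m f g 0) ?big_ord1 ?subr0//.
by rewrite mulf_neq0.
Qed.

Lemma sphere1 : sphere 0 1.
Proof.
split; first by rewrite lcoef1 oner_eq0.
by move=> m m1; rewrite lcoef1; case: eqP => // m0; lia.
Qed.

Lemma sphereV n f : sphere n f -> sphere (- n) f^-1.
Proof.
move=> fn; have f0 := sphere_neq0 fn.
have [m fm] := sphere_ex (invr_neq0 f0).
have := sphereM fn fm; rewrite divff// => /(sphere_inj sphere1) mn.
by have -> : - n = m by lia.
Qed.

Lemma sphereVE n f : sphere n f^-1 <-> sphere (- n) f.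
Proof. by split=> /sphereV; rewrite ?opprK ?invrK. Qed.

Lemma smallMl r n f g : small r f -> sphere n g -> small (r + n) (f * g).
Proof. by move=> fr [_ g1]; have := smallM fr g1; apply: small_le; lia. Qed.

Lemma lball_sphere n r a f : r <= n -> lball a r f -> sphere n a -> sphere n f.
Proof.
move=> rn fa an; rewrite -(subrK a f) addrC; apply: sphereD => //.
exact: small_le fa.
Qed.

Lemma lballC a b r : lball a r b <-> lball b r a.
Proof. by split=> /smallN; rewrite opprB. Qed.

Lemma lball_refl a r : lball a r a.
Proof. by move=> m _; rewrite subrr. Qed.

Lemma lball_trans b a c r : lball a r b -> lball b r c -> lball a r c.
Proof.
move=> ab bc; rewrite /lball /=.
have -> : c - a = (b - a) + (c - b) by ring.
exact: smallD.
Qed.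

Lemma lballE a b r : lball a r b -> lball a r = lball b r.
Proof.
move=> ab; apply/seteqP; split=> f; last exact: lball_trans.
by apply: lball_trans; exact/lballC.
Qed.

Lemma lball_le a r s : r <= s -> lball a r `<=` lball a s.
Proof. by move=> rs f; exact: small_le. Qed.

Lemma lball0E r f : lball 0 r f <-> small r f.
Proof. by rewrite /lball /= subr0. Qed.

(* Inversion scales distances by |f|^-2 on the sphere through f. *)
Lemma lballV n r b f : sphere n b -> r <= n ->
  lball b r f <-> lball b^-1 (r - n *+ 2) f^-1.
Proof.
have half n' r' (b' f' : laurent F) : sphere n' b' -> r' <= n' ->
    lball b' r' f' -> lball b'^-1 (r' - n' *+ 2) f'^-1.
  move=> bn rn fb; have fn := lball_sphere rn fb bn.
  have f0 := sphere_neq0 fn; have b0 := sphere_neq0 bn.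
  rewrite /lball /=.
  have -> : f'^-1 - b'^-1 = (b' - f') * f'^-1 * b'^-1 by field; rewrite b0 f0.
  have -> : r' - n' *+ 2 = r' - n' - n' by lia.
  apply: smallMl (sphereV bn); apply: smallMl (sphereV fn).
  by move/lballC: fb.
move=> bn rn; split; first exact: half.
move=> /(half _ _ _ _ (sphereV bn)); rewrite !invrK.
have -> : r - n *+ 2 - (- n) *+ 2 = r by lia.
by apply; lia.
Qed.

Lemma lpoly_partE f m : lpoly_part f m = if 0 <= m then f m else 0.
Proof. by []. Qed.

Definition lfrac f := f - lpoly_part f.

Lemma lfracE f m : lfrac f m = if 0 <= m then 0 else f m.
Proof. by rewrite lcoefB lpoly_partE; case: ifP; rewrite ?subrr ?subr0. Qed.

Lemma lfrac_small f : small 0 (lfrac f).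
Proof. by move=> m m0; rewrite lfracE m0. Qed.

Lemma lfrac_id f : small 0 f -> lfrac f = f.
Proof. by move=> f0; apply: laurentP => m; rewrite lfracE; case: ifP => // /f0. Qed.

Lemma lfracB f g : lfrac (f - g) = lfrac f - lfrac g.
Proof.
by apply: laurentP => m; rewrite lcoefB !lfracE lcoefB; case: ifP; rewrite ?subr0.
Qed.

End small.

(** * The Farey map in the coordinate 1/f *)

Section farey_step.
Variables (F : fieldType) (h : laurent F).
Hypothesis hS : sphere (-1) h.
Implicit Types (f g x : laurent F) (n r : int).

(* In the coordinate [g = f^-1], the Farey map is this additive map. *)
Definition fstep g := g - lpoly_part ((1 - h) * g).

(** From [(1 - h) g] = [g] - [h g]: the polynomial part of g gives way to that of h g, and the
    fractional part stays. *)
Lemma fstepE g m : fstep g m = if 0 <= m then (h * g) m else g m.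
Proof.
rewrite lcoefB lpoly_partE; case: ifP => _; last by rewrite subr0.
by rewrite mulrBl mul1r lcoefB opprB addrC subrK.
Qed.

Lemma fstepB f g : fstep (f - g) = fstep f - fstep g.
Proof.
by apply: laurentP => m; rewrite lcoefB !fstepE mulrBr !lcoefB; case: ifP.
Qed.

Lemma lfrac_fstep g : lfrac (fstep g) = lfrac g.
Proof. by apply: laurentP => m; rewrite !lfracE fstepE; case: (0 <= m). Qed.

Lemma small_hM r g : small r g -> small (r - 1) (h * g).
Proof. by move=> gr; rewrite mulrC; apply: smallMl. Qed.

Lemma fstep_lfrac g : small 1 g -> fstep g = lfrac g.
Proof.
move=> /small_hM hg; apply: laurentP => m; rewrite fstepE lfracE.
by case: ifP => // m0; apply: hg; rewrite subrr.
Qed.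

Lemma fstep_id g : small 0 g -> fstep g = g.
Proof.
by move=> g0; rewrite fstep_lfrac ?lfrac_id//; apply: small_le g0.
Qed.

(** The product h g has degree n - 1 >= 0, so its leading term lies in the polynomial part and
    survives. *)
Lemma fstep_sphere n g : 0 < n -> sphere n g -> sphere (n - 1) (fstep g).
Proof.
move=> n0 gn; have := sphereM hS gn; rewrite addrC => -[hg0 hg1]; split.
  by rewrite fstepE ifT//; lia.
by move=> m nm; rewrite fstepE ifT ?hg1//; lia.
Qed.

(** This is the source of the factor q in [haar_fstep]: an open unit ball is pulled back to a closed
    one. *)
Lemma fstep_small0 g : small 0 (fstep g) <-> small 1 g.
Proof.
split=> [g0|g1]; last by rewrite fstep_lfrac//; exact: lfrac_small.
have [->//|/sphere_ex[n gn]] := eqVneq g 0.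
rewrite (sphere_small _ gn) ltNge; apply/negP => n1.
have := sphere_small 0 (fstep_sphere (lt_le_trans ltr01 n1) gn).
by move=> [/(_ g0)]; lia.
Qed.

Lemma fstep_sphereE n g : 0 < n -> sphere (n - 1) (fstep g) <-> sphere n g.
Proof.
move=> n0; split=> [gn|]; last exact: fstep_sphere.
have g0 : ~ small 1 g by rewrite -fstep_small0 (sphere_small 0 gn); lia.
have [g00|/sphere_ex[m gm]] := eqVneq g 0; first by case: g0; rewrite g00.
have m0 : 0 < m by move: g0; rewrite (sphere_small 1 gm); lia.
have := sphere_inj gn (fstep_sphere m0 gm).
by move=> nm; have -> : n = m by lia.
Qed.

Lemma fstep_surj x : exists g, fstep g = x.
Proof.
have h0 := sphere_neq0 hS.
(* Here p is h^-1 [x] rounded to a polynomial. Multiplied by h, both the rounding error and {x} have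
   degree below -1, so neither affects the polynomial part of the image. *)
pose p := lpoly_part (h^-1 * lpoly_part x); exists (p + lfrac x).
have -> : p = h^-1 * lpoly_part x - lfrac (h^-1 * lpoly_part x).
  by rewrite /lfrac opprB addrC subrK.
apply: laurentP => m.
rewrite fstepE; case: ifP => m0; last first.
  rewrite lcoefD lcoefB !lfracE m0 subrr add0r.
  by [].
rewrite mulrDr mulrBr mulrA divff// mul1r !(lcoefD, lcoefB).
rewrite lcoefN lpoly_partE m0 (small_hM (@lfrac_small _ (h^-1 * lpoly_part x))) ?subr0; last by lia.
by rewrite (small_hM (@lfrac_small _ x)) ?addr0//; lia.
Qed.

(** The convention 0^-1 = 0 lets the formula cover f = 0 as well. *)
Lemma farey_lt f : small 0 f -> farey h f = (fstep f^-1)^-1.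
Proof.
move=> f0; rewrite /farey; case: eqVneq => [->|fn0].
  by rewrite invr0 fstep_id// invr0.
rewrite ifT; last by apply/ldeg_le => m m0; apply: f0; lia.
rewrite /fstep; set p := lpoly_part _.
have -> : f^-1 - p = (1 - p * f) / f by field.
by rewrite invf_div.
Qed.

Lemma farey_deg0 f : sphere 0 f -> farey h f = fstep f^-1.
Proof.
move=> fS; rewrite /farey (negPf (sphere_neq0 fS)) ifF; last first.
  by move/sphere_ldeg : fS => ->; rewrite lee_fin; lia.
by rewrite /fstep; field; exact: sphere_neq0 fS.
Qed.

End farey_step.

(** * Borel sets generated by balls, and measurability of the maps *)

Section borel.
Variable F : finFieldType.
Implicit Types (f g a b : laurent F) (U V : set (laurent F)) (r s n : int).

Lemma laurent_open_lballP U :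
  open U <-> forall f, U f -> exists r, lball f r `<=` U.
Proof.
rewrite -[open U]/(laurent_open U); split=> Uo f /Uo[r rU]; exists r => g.
  by move=> /ldeg_ltP; exact: rU.
by move=> /ldeg_ltP; exact: rU.
Qed.

Lemma open_measurable_laurent U : open U -> measurable U.
Proof. exact: sub_sigma_algebra. Qed.

Lemma lball_open a r : open (lball a r).
Proof.
by apply/laurent_open_lballP => f af; exists r; rewrite -(lballE af).
Qed.

Lemma measurable_lball a r : measurable (lball a r).
Proof. by apply: open_measurable_laurent; exact: lball_open. Qed.

Lemma sphere_lballD n : @sphere F n = lball 0 (n + 1) `\` lball 0 n.
Proof.
by apply/seteqP; split=> f; rewrite /setD /= !lball0E sphereE.
Qed.

Lemma measurable_sphere n : measurable (@sphere F n).
Proof. by rewrite sphere_lballD; apply: measurableD; exact: measurable_lball. Qed.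

Lemma laurent_neq0_open : open [set f : laurent F | f != 0].
Proof.
apply/laurent_open_lballP => f /= /sphere_ex[n fn]; exists n => g gf.
exact/sphere_neq0/(lball_sphere (lexx n) gf fn).
Qed.

Lemma measurable_laurent0 : measurable [set 0 : laurent F].
Proof.
have -> : [set 0] = ~` [set f : laurent F | f != 0].
  by apply/seteqP; split=> f /=; [move=> ->; rewrite eqxx|move=> /negP/negPn/eqP].
apply: measurableC; apply: open_measurable_laurent; exact: laurent_neq0_open.
Qed.

Lemma laurent_seq_bounded (N : int) (s : seq F) :
  exists M : int, forall m, M < m -> (if m <= N then s`_(absz (N - m)) else 0) = 0.
Proof. by exists N => m; rewrite ltNge => /negPf ->. Qed.

(** Finite coefficient lists read downwards from degree N; as F is finite, these form a countable
    dense set. *)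
Definition laurent_seq N (s : seq F) : laurent F := Laurent (laurent_seq_bounded N s).

Lemma laurent_seq_dense f r : exists N (s : seq F), lball f r (laurent_seq N s).
Proof.
have [N fN] := lcoef_bounded f.
exists N, (mkseq (fun i => f (N - i%:Z)) (absz (N - r)).+1) => m rm.
rewrite lcoefB /=; case: ifP => mN; last by rewrite fN ?subr0//; lia.
have -> : m = N - (absz (N - m))%:Z by lia.
rewrite nth_mkseq; last by lia.
by rewrite [X in f (N - X)](_ : _ = (absz (N - m))%:Z) ?subrr//; lia.
Qed.

Definition laurent_balls : set (set (laurent F)) :=
  [set B | B = set0 \/ exists a r, B = lball a r].

(** Two ultrametric balls that meet share a centre, hence are nested; with the empty set added,
    balls form a pi-system. *)
Lemma laurent_ballsI : setI_closed laurent_balls.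
Proof.
move=> A B [->|[a [r ->]]]; first by left; rewrite set0I.
move=> [->|[b [s ->]]]; first by left; rewrite setI0.
have [[c /= [ac bc]]|nc] := pselect (exists c, (lball a r `&` lball b s) c); last first.
  by left; apply/seteqP; split=> // c cab; apply: nc; exists c.
right; rewrite (lballE ac) (lballE bc).
have [rs|/ltW sr] := leP r s; exists c.
  by exists r; apply/setIidPl; exact: lball_le.
by exists s; apply/setIidPr; exact: lball_le.
Qed.

Lemma measurable_laurent_balls :
  @measurable _ (laurent F) = <<s laurent_balls >>.
Proof.
apply/seteqP; split; last first.
  apply: smallest_sub; first exact: sigma_algebra_measurable.
  by move=> _ [->|[a [r ->]]]; [exact: measurable0|exact: measurable_lball].
apply: smallest_sub; first exact: smallest_sigma_algebra.
move=> U /laurent_open_lballP Uo.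
(* An index holds a radius and a centre from the dense set, so U is a countable union of balls;
   those not inside U are replaced by the empty set. *)
pose c (i : int * int * seq F) := laurent_seq i.1.2 i.2.
pose B (i : int * int * seq F) : set (g_sigma_algebraType laurent_balls) :=
  if `[< lball (c i) i.1.1 `<=` U >] then lball (c i) i.1.1 else set0.
have -> : U = \bigcup_i B i.
  apply/seteqP; split=> f; last first.
    by move=> [i _]; rewrite /B; case: ifP => // /asboolP; exact.
  move=> /Uo[r rU]; have [N [s fs]] := laurent_seq_dense f r.
  exists (r, N, s) => //; rewrite /B /c /=.
  rewrite -(lballE fs) ifT; last exact/asboolP.
  exact: lball_refl.
rewrite -[<<s _ >> _]/(measurable (\bigcup_i B i)).
apply: countable_bigcupT_measurable => [|i]; first exact: countableP.
rewrite -[measurable _]/(<<s laurent_balls >> (B i)) /B.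
by case: ifP => _; apply: sub_sigma_algebra; [right; exists (c i), i.1.1|left].
Qed.

Lemma laurent_ball_cover :
  \bigcup_k lball (0 : laurent F) k%:Z = setT.
Proof.
apply/seteqP; split=> // f _; have [N fN] := lcoef_bounded f.
exists (absz N).+1 => //; apply/lball0E => m Nm; apply: fN; lia.
Qed.

(** The main tool for identities between measures: balls form a generating pi-system, and the balls
    around 0 exhaust the space with finite measure. *)
Lemma lball_measure_unique (R : realType)
    (m1 m2 : {measure set (laurent F) -> \bar R}) :
  (forall a r, m1 (lball a r) = m2 (lball a r)) ->
  (forall r, (m1 (lball 0%R r) < +oo)%E) ->
  forall D, measurable D -> m1 D = m2 D.
Proof.
move=> m12 m1oo D; apply: (measure_unique laurent_balls (fun k => lball 0 k%:Z)).
- exact: measurable_laurent_balls.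
- exact: laurent_ballsI.
- by move=> k; right; exists 0, k%:Z.
- exact: laurent_ball_cover.
- by move=> _ [->|[a [r ->]]]; [rewrite !measure0|exact: m12].
- by move=> k; exact: m1oo.
Qed.

(** Continuity away from 0 is enough because {0} is a Borel set; inversion is not continuous at
    0. *)
Lemma measurable_fun_laurent (phi : laurent F -> laurent F) :
  (forall a r, a != 0 -> exists s, lball a s `<=` phi @^-1` lball (phi a) r) ->
  measurable_fun setT phi.
Proof.
move=> cphi; apply: (measurability (@open (laurent F))) => //.
move=> _ [U /laurent_open_lballP Uo <-]; rewrite setTI.
(* The preimage splits into its trace on {0} and an open set. *)
rewrite -(setUIDK (phi @^-1` U) [set 0]); apply: measurableU.
  have [U0|U0] := pselect (U (phi 0)).
    by rewrite setIidr; [exact: measurable_laurent0|move=> _ ->].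
  by rewrite [X in measurable X](_ : _ = set0)//; apply/seteqP; split=> // f [+ f0]; rewrite f0.
apply: open_measurable_laurent; apply/laurent_open_lballP => f [/= Uf /eqP f0].
have [r rU] := Uo _ Uf; have [s sf] := cphi f r f0.
have [n fn] := sphere_ex f0; exists (Order.min s n) => g gf; split.
  by apply/rU/sf; apply: lball_le gf; rewrite ge_min lexx.
apply/eqP/(@sphere_neq0 _ n)/(lball_sphere _ gf fn).
by rewrite ge_min lexx orbT.
Qed.

Lemma measurable_preimage_laurent (phi : laurent F -> laurent F) D :
  measurable_fun setT phi -> measurable D -> measurable (phi @^-1` D).
Proof. by move=> mphi mD; rewrite -[X in measurable X]setTI; exact: mphi. Qed.

Lemma measurable_linv : measurable_fun setT (@GRing.inv (laurent F)).
Proof.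
apply: measurable_fun_laurent => a r /sphere_ex[n an].
exists (Order.min n (r + n *+ 2)) => f fa /=.
have := fa; rewrite (lballV f an); last by rewrite ge_min lexx.
by apply: small_le; rewrite lerBlDr ge_min lexx orbT.
Qed.

Lemma measurable_fstep (h : laurent F) : sphere (-1) h -> measurable_fun setT (fstep h).
Proof.
move=> hS; apply: measurable_fun_laurent => a r _.
(* An additive map that is the identity on the open unit ball preserves small distances. *)
exists (Order.min r 0) => f fa; rewrite /preimage /lball /= -fstepB fstep_id//.
  by apply: small_le fa; rewrite ge_min lexx.
by apply: small_le fa; rewrite ge_min lexx orbT.
Qed.

Lemma measurable_lfrac : measurable_fun setT (@lfrac F).
Proof.
apply: measurable_fun_laurent => a r _.
exists (Order.min r 0) => f fa; rewrite /preimage /lball /= -lfracB lfrac_id//.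
  by apply: small_le fa; rewrite ge_min lexx.
by apply: small_le fa; rewrite ge_min lexx orbT.
Qed.

End borel.

(** * Measures that depend only on the radius of a ball *)

Section ball_measure.
Variables (R : realType) (F : finFieldType).
Local Notation q := (#|F|%:R : R).
Implicit Types (a f : laurent F) (r n : int).

Lemma field_card_gt0 : 0 < q.
Proof. by rewrite ltr0n (ltn_trans _ (card_finNzRing_gt1 F)). Qed.

Lemma lmono_bounded (c : F) r :
  exists N : int, forall n, N < n -> (if n == r then c else 0) = 0.
Proof. by exists r => n; case: eqP => // ->; rewrite ltxx. Qed.

Definition lmono (c : F) r : laurent F := Laurent (lmono_bounded c r).

Lemma lmonoE c r m : lmono c r m = if m == r then c else 0.
Proof. by []. Qed.

(** The pieces are indexed by the coefficient at t^r of the difference from the centre. *)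
Lemma lball_split a r :
  lball a (r + 1) = \bigcup_(c in [set: F]) lball (a + lmono c r) r.
Proof.
apply/seteqP; split=> [f fa|f [c _ fc]].
  exists ((f - a) r) => // m rm; rewrite opprD addrA !lcoefB lmonoE.
  by case: eqP => [->|mr]; [rewrite subrr|rewrite subr0 -lcoefB fa//; lia].
move=> m rm; have := fc m; rewrite opprD addrA !lcoefB lmonoE.
by case: eqP => [|_]; [lia|rewrite subr0; apply; lia].
Qed.

Lemma lball_split_measure (m : {measure set (laurent F) -> \bar R}) r v :
  (forall a, m (lball a r) = v) ->
  forall a, m (lball a (r + 1)) = (q%:E * v)%E.
Proof.
move=> mv a; rewrite lball_split measure_fin_bigcup//; last 2 first.
- apply/trivIsetP => c d _ _ /eqP cd; apply/seteqP; split=> // f [fc fd].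
  apply: cd; have := fc r (lexx r); have := fd r (lexx r).
  rewrite !lcoefB !lcoefD !lmonoE eqxx => fd0 fc0.
  by apply: (addrI (a r)); rewrite -(subr0_eq fc0) -(subr0_eq fd0).
- by move=> c _; exact: measurable_lball.
rewrite (fsbigE (enum F)) ?enum_uniq// => [|c _]; last by rewrite mem_enum.
rewrite (eq_bigr (fun=> v)) => [|c _]; last exact: mv.
rewrite (eq_bigl xpredT) => [|c]; last by rewrite in_setT.
by rewrite big_enum sumr_const mule_natl.
exact: finite_finset.
Qed.

Lemma lball_measure (m : {measure set (laurent F) -> \bar R}) v :
  (forall a r, m (lball a r) = m (lball 0 r)) -> m (lball 0 0) = v%:E ->
  forall a r, m (lball a r) = (v * q ^ r)%:E.
Proof.
move=> minv m0 a r; rewrite minv.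
have q0 : q != 0 by rewrite gt_eqF// field_card_gt0.
have step s : m (lball 0%R (s + 1)) = (q%:E * m (lball 0%R s))%E.
  by apply: lball_split_measure => b; exact: minv.
(* The relation between radii s and s + 1 is followed downwards from 0, then upwards. *)
have neg (n : nat) : m (lball 0 (- n%:Z)) = (v * q ^ (- n%:Z))%:E.
  elim: n => [|n IH]; first by rewrite oppr0 expr0z mulr1.
  have := step (- n.+1%:Z); have -> : - n.+1%:Z + 1 = - n%:Z by lia.
  rewrite IH => /(congr1 (fun x => (q^-1)%:E * x)%E).
  rewrite muleA -!EFinM mulVf// mul1e => <-; congr EFin.
  have -> : - n.+1%:Z = - n%:Z - 1 by lia.
  by rewrite expfzDr// exprN1; ring.
have pos (n : nat) : m (lball 0 n%:Z) = (v * q ^ n%:Z)%:E.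
  elim: n => [|n IH]; first by rewrite expr0z mulr1.
  have -> : n.+1%:Z = n%:Z + 1 by lia.
  by rewrite step IH -EFinM expfzDr// expr1z mulrCA (mulrC q).
case: (leP 0 r) => r0.
  by have -> : r = `|r|%N%:Z by lia.
by have -> : r = - `|r|%N%:Z by lia.
Qed.

End ball_measure.

(** * Haar measure under the Farey step and under inversion *)

Section haar.
Variables (R : realType) (F : finFieldType).
Local Notation q := (#|F|%:R : R).
Variable mu : {measure set (laurent F) -> \bar R}.
Hypothesis mu_shift :
  forall (a : laurent F) (D : set (laurent F)), measurable D -> mu [set a + f | f in D] = mu D.
Hypothesis mu_unit : mu (lball 0 1) = 1%E.
Implicit Types (a f g : laurent F) (r n : int) (D : set (laurent F)).

Let q0 : q != 0. Proof. by rewrite gt_eqF// field_card_gt0. Qed.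

Lemma lball_shift a b r : lball (a + b) r = [set a + f | f in lball b r].
Proof.
apply/seteqP; split=> [f fab|_ [f fb <-]].
  exists (f - a); last by rewrite addrC subrK.
  by rewrite /lball /= -addrA -opprD.
rewrite /lball /=; have -> : a + f - (a + b) = f - b by ring.
exact: fb.
Qed.

Lemma haar_lball a r : mu (lball a r) = (q ^ (r - 1))%:E.
Proof.
have inv b s : mu (lball b s) = mu (lball 0 s).
  by rewrite -[b]addr0 lball_shift mu_shift//; exact: measurable_lball.
(* The normalization is at radius 1, so the ball of radius 0 has measure 1/q. *)
have /esym := lball_split_measure (fun b => inv b 0) 0; rewrite add0r mu_unit.
move=> /(congr1 (fun x => (q^-1)%:E * x)%E).
rewrite muleA -!EFinM mulVf// mul1e mulr1 => m0.
by rewrite (lball_measure inv m0) mulrC expfzDr// exprN1.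
Qed.

Lemma haar_lt_pinfty a r : (mu (lball a r) < +oo)%E.
Proof. by rewrite haar_lball ltry. Qed.

Lemma haar_sphere n : mu (sphere n) = (q ^ n - q ^ (n - 1))%:E.
Proof.
have sub : lball (0 : laurent F) n `<=` lball 0 (n + 1) by apply: lball_le; lia.
rewrite sphere_lballD (measureD (measurable_lball _ _) (measurable_lball _ _)) //=.
  by rewrite (setIidr sub) !haar_lball addrK.
exact: haar_lt_pinfty.
Qed.

Lemma haar0 : mu [set 0] = 0%E.
Proof.
apply/eqP; rewrite -measure_le0; apply/lee_addgt0Pr => e e0; rewrite add0e.
have [k ke] : exists k : nat, e^-1 < k%:R.
  by exists (Num.truncn e^-1).+1; rewrite truncnS_gt.
(* This ball has measure q^-k, and q^k > k > 1/e. *)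
apply: (@le_trans _ _ (mu (lball 0 (1 - k%:Z)))).
  apply: le_measure; rewrite ?inE; [exact: measurable_laurent0|exact: measurable_lball|].
  by move=> _ ->; apply/lball0E.
rewrite haar_lball lee_fin addrAC subrr add0r -invr_expz -exprnP.
rewrite invf_ple ?posrE ?exprn_gt0 ?field_card_gt0//.
apply: (le_trans (ltW ke)).
by rewrite -natrX ler_nat ltnW// ltn_expl// card_finNzRing_gt1.
Qed.

(** As [fstep h] is additive and onto, the pushforward of [mu] is translation invariant on balls;
    its value on the open unit ball fixes the factor. *)
Lemma haar_fstep h D : sphere (-1) h -> measurable D ->
  mu (fstep h @^-1` D) = (q%:E * mu D)%E.
Proof.
move=> hS mD; have mh := measurable_fstep hS.
have qge0 : 0 <= q by rewrite ltW// field_card_gt0.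
have inv a r : mu (fstep h @^-1` lball a r) = mu (fstep h @^-1` lball 0 r).
  (* Translation by a preimage b of the centre carries one preimage of a ball onto the other. *)
  have [b <-] := fstep_surj hS a.
  rewrite -[RHS](mu_shift b); last exact: measurable_preimage_laurent (measurable_lball _ _).
  congr (mu _); apply/seteqP; split=> [f fb|_ [f fb <-]].
    exists (f - b); last by rewrite addrC subrK.
    by rewrite /preimage /= lball0E fstepB.
  move: fb; rewrite /preimage /= lball0E /lball /= -fstepB.
  by have -> : b + f - b = f by ring.
have unit : mu (fstep h @^-1` lball 0 0) = 1%E.
  rewrite -mu_unit; congr (mu _); apply/seteqP.
  by split=> g; rewrite /preimage /= !lball0E fstep_small0.
have ball a r : mu (fstep h @^-1` lball a r) = (q ^ r)%:E.
  rewrite -[LHS]/(pushforward mu (fstep h) (lball a r)).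
  by rewrite (@lball_measure _ _ (pushforward mu (fstep h)) 1) ?mul1r.
rewrite -[LHS]/(pushforward mu (fstep h) D) -[RHS]/(mscale (NngNum qge0) mu D).
apply: lball_measure_unique => // [a r|r].
  rewrite [LHS]ball -[RHS]/(q%:E * mu (lball a r))%E haar_lball -EFinM.
  by rewrite -[q in q * _]expr1z -expfzDr// addrCA subrr addr0.
by rewrite [X in (X < _)%E]ball ltry.
Qed.

(** By [lballV], inversion turns radius r into r - 2n on the sphere of degree n, so it scales all
    balls there by the same factor. *)
Lemma haar_linv n D : measurable D ->
  mu (GRing.inv @^-1` D `&` sphere (- n)) = ((q ^ (- (n *+ 2)))%:E * mu (D `&` sphere n))%E.
Proof.
move=> mD; have mV := @measurable_linv F.
have cge0 : 0 <= q ^ (- (n *+ 2)) by rewrite exprz_ge0// ltW// field_card_gt0.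
pose mr k := mrestr mu (@measurable_sphere F k).
rewrite -[LHS]/(pushforward (mr (- n)) GRing.inv D).
rewrite -[RHS]/(mscale (NngNum cge0) (mr n) D).
have key a r : mu (GRing.inv @^-1` lball a r `&` sphere (- n)) =
    ((q ^ (- (n *+ 2)))%:E * mu (lball a r `&` sphere n))%E.
  (* Three cases: the ball misses the sphere, lies inside it (r <= n), or contains it (n < r). *)
  have [[b [ab bn]]|nb] := pselect (exists b, lball a r b /\ sphere n b); last first.
    rewrite [_ `&` sphere (- n)](_ : _ = set0).
      rewrite [_ `&` sphere n](_ : _ = set0) ?measure0 ?mule0//.
      by apply/seteqP; split=> // f [fa fn]; apply: nb; exists f.
    by apply/seteqP; split=> // f [fa /sphereVE fn]; apply: nb; exists f^-1.
  rewrite (lballE ab); have [rn|nr] := leP r n.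
    rewrite [_ `&` sphere n](_ : _ = lball b r); last first.
      by apply/setIidPl => f fb; exact: lball_sphere rn fb bn.
    rewrite [_ `&` sphere (- n)](_ : _ = lball b^-1 (r - n *+ 2)); last first.
      apply/seteqP; split=> f.
        by move=> [fb fn]; move: fb; rewrite /preimage /= (lballV _ bn rn) invrK.
      move=> fb; split; last by apply: (lball_sphere _ fb (sphereV bn)); lia.
      by rewrite /preimage /= (lballV _ bn rn) invrK.
    rewrite [mu _]haar_lball [in RHS]haar_lball -EFinM -expfzDr//.
    by congr (_ ^ _)%:E; lia.
  have sub k : k < r -> @sphere F k `<=` lball 0 r.
    by move=> kr f /(sphere_small r) [_ ]; rewrite lball0E; apply.
  have -> : lball b r = lball 0 r by rewrite (lballE (sub _ nr _ bn)).
  rewrite [_ `&` sphere n](_ : _ = sphere n); last first.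
    by apply/setIidPr; exact: sub.
  rewrite [_ `&` sphere (- n)](_ : _ = sphere (- n)); last first.
    by apply/setIidPr => f /sphereVE; exact: sub.
  rewrite [mu _]haar_sphere [in RHS]haar_sphere -EFinM; congr EFin.
  by rewrite mulrBr -!expfzDr//; congr (_ ^ _ - _ ^ _); lia.
apply: lball_measure_unique => // r.
rewrite [X in (X < _)%E]key.
apply: (@le_lt_trans _ _ ((q ^ (- (n *+ 2)))%:E * mu (lball 0%R r))%E).
  apply: lee_wpmul2l; first by rewrite lee_fin.
  apply: le_measure; rewrite ?inE//; last exact: measurable_lball.
  by apply: measurableI; [exact: measurable_lball|exact: measurable_sphere].
by rewrite haar_lball -EFinM ltry.
Qed.

End haar.

(** * Measures of preimages under the two branches of the Farey map *)

Section farey_measure.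
Variables (R : realType) (F : finFieldType).
Local Notation q := (#|F|%:R : R).
Variable mu : {measure set (laurent F) -> \bar R}.
Hypothesis mu_shift :
  forall (a : laurent F) (D : set (laurent F)), measurable D -> mu [set a + f | f in D] = mu D.
Hypothesis mu_unit : mu (lball 0 1) = 1%E.
Variable h : laurent F.
Hypothesis hS : sphere (-1) h.
Implicit Types (a f g : laurent F) (r n : int) (D E : set (laurent F)).

Let q0 : q != 0. Proof. by rewrite gt_eqF// field_card_gt0. Qed.
Let q_gt1 : 1 < q. Proof. by rewrite ltr1n card_finNzRing_gt1. Qed.

Lemma lball_layers r :
  lball (0 : laurent F) r = [set 0] `|` \bigcup_k sphere (r - 1 - k%:Z).
Proof.
apply/seteqP; split=> f.
  move=> /lball0E fr; have [->|/sphere_ex[n fn]] := eqVneq f 0; first by left.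
  right; exists (absz (r - 1 - n)%R) => //.
  have nr : n < r by rewrite -(sphere_small r fn).
  by have -> : r - 1 - (absz (r - 1 - n)%R)%:Z = n by lia.
case=> [-> //|[k _ fk]]; first exact/lball0E.
by apply/lball0E; rewrite (sphere_small r fk); lia.
Qed.

(** The point 0 is null, so the spheres carry all the mass. *)
Lemma measure_layers D r : measurable D ->
  mu (D `&` lball 0 r) = (\sum_(k <oo) mu (D `&` sphere (r - 1 - k%:Z)))%E.
Proof.
move=> mD; rewrite lball_layers setIUr measureU; last 3 first.
- by apply: measurableI => //; exact: measurable_laurent0.
- apply: measurableI => //; apply: bigcup_measurable => k _.
  exact: measurable_sphere.
- apply/seteqP; split=> // f [[_ ->] [_ [k _ /sphere_neq0]]].
  by rewrite eqxx.
rewrite [X in (X + _)%E](_ : _ = 0%E) ?add0e; last first.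
  apply/eqP; rewrite -measure_le0 -[leRHS](haar0 mu_shift mu_unit).
  apply: le_measure; rewrite ?inE; last by move=> f [].
    by apply: measurableI => //; exact: measurable_laurent0.
  exact: measurable_laurent0.
rewrite setI_bigcupr; apply: measure_semi_bigcup.
- by move=> k; apply: measurableI => //; exact: measurable_sphere.
- apply/trivIsetP => i j _ _ /eqP ij; apply/seteqP; split=> // f [[_ fi] [_ fj]].
  by apply: ij; have := sphere_inj fi fj; lia.
- apply: bigcup_measurable => k _; apply: measurableI => //.
  exact: measurable_sphere.
Qed.

Let psi f := (fstep h f^-1)^-1.

Lemma measurable_farey_lt : measurable_fun setT psi.
Proof.
apply: (@measurableT_comp _ _ _ _ _ _ (@GRing.inv (laurent F))).
  exact: measurable_linv.
apply: (@measurableT_comp _ _ _ _ _ _ (fstep h)); first exact: measurable_fstep.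
exact: measurable_linv.
Qed.

Lemma measurable_farey_deg0 : measurable_fun setT (fun f => fstep h f^-1).
Proof.
apply: (@measurableT_comp _ _ _ _ _ _ (fstep h)); first exact: measurable_fstep.
exact: measurable_linv.
Qed.

(** Invert, step, invert: the degree runs through -n, n, n - 1, 1 - n, and the factors q^(-2n), q
    and q^(-2(1-n)) multiply to 1/q. *)
Lemma farey_layer D n : measurable D -> 0 < n ->
  mu (psi @^-1` D `&` sphere (- n)) = ((q^-1)%:E * mu (D `&` sphere (1 - n)))%E.
Proof.
move=> mD n0; have mV := @measurable_linv F; have mh := measurable_fstep hS.
have mVD : measurable (GRing.inv @^-1` D) by exact: measurable_preimage_laurent.
rewrite -[psi @^-1` D]/(GRing.inv @^-1` (fstep h @^-1` (GRing.inv @^-1` D))).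
rewrite haar_linv//; last exact: measurable_preimage_laurent.
have -> : fstep h @^-1` (GRing.inv @^-1` D) `&` sphere n =
    fstep h @^-1` (GRing.inv @^-1` D `&` sphere (n - 1)).
  by apply/seteqP; split=> f [fD fn]; split=> //; move: fn; rewrite /preimage /= fstep_sphereE.
rewrite haar_fstep//; last by apply: measurableI => //; exact: measurable_sphere.
have -> : n - 1 = - (1 - n) by lia.
rewrite haar_linv// !muleA -!EFinM; congr (_%:E * _)%E.
rewrite -mulrA -[q in X in _ * X]expr1z -!expfzDr// -exprN1.
by congr (_ ^ _); lia.
Qed.

Lemma farey_lt_measure D : measurable D ->
  mu (psi @^-1` D `&` lball 0 0) = ((q^-1)%:E * mu (D `&` lball 0%R 1))%E.
Proof.
move=> mD; rewrite measure_layers; last first.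
  exact: measurable_preimage_laurent measurable_farey_lt mD.
rewrite measure_layers// -nneseriesZl//.
apply: eq_eseriesr => k _.
have -> : 0 - 1 - k%:Z = - (k%:Z + 1) by lia.
rewrite farey_layer//; congr (_ * mu (_ `&` sphere _))%E; lia.
Qed.

Lemma haar_lball_fin D a r : measurable D -> mu (D `&` lball a r) \is a fin_num.
Proof.
move=> mD; rewrite ge0_fin_numE ?measure_ge0//.
apply: le_lt_trans (haar_lt_pinfty mu_shift mu_unit a r).
by apply: le_measure; rewrite ?inE//; [apply: measurableI => //|]; exact: measurable_lball.
Qed.

(** Inversion preserves measure on the unit sphere. The step pulls D in the open unit ball back to a
    set of q times its measure, of which the copy of D inside that ball, where the step is the
    identity, must be removed. *)
Lemma farey_deg0_measure D : measurable D ->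
  mu ((fun f => fstep h f^-1) @^-1` D `&` sphere 0) = ((q - 1)%:E * mu (D `&` lball 0%R 0))%E.
Proof.
move=> mD; have mh := measurable_fstep hS.
have mDL : measurable (D `&` lball 0 0).
  by apply: measurableI => //; exact: measurable_lball.
have mhDL := measurable_preimage_laurent mh mDL.
rewrite -[_ @^-1` D]/(GRing.inv @^-1` (fstep h @^-1` D)) -[X in sphere X]oppr0.
rewrite haar_linv//; last exact: measurable_preimage_laurent.
rewrite mul0rn oppr0 expr0z mul1e.
have -> : fstep h @^-1` D `&` sphere 0 =
    fstep h @^-1` (D `&` lball 0 0) `\` (D `&` lball 0 0).
  apply/seteqP; split=> f.
    move=> [fD f0]; split; last by move=> [_ /lball0E]; rewrite (sphere_small 0 f0) ltxx.
    by split=> //; apply/lball0E; rewrite fstep_small0//; case: f0.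
  move=> [[fD]]; rewrite lball0E fstep_small0// => f1 fn; split=> //.
  apply/sphereE; split=> // f0; apply: fn; split; last exact/lball0E.
  by move: fD; rewrite /preimage /= fstep_id.
have sub : D `&` lball 0 0 `<=` fstep h @^-1` (D `&` lball 0 0).
  by move=> f [fD /lball0E f0]; rewrite /preimage /= fstep_id//; split=> //; exact/lball0E.
have fin := haar_lball_fin 0 0 mD.
have hE := haar_fstep mu_shift mu_unit hS mDL.
rewrite measureD//= ?(setIidr sub) ?hE.
  by rewrite -(fineK fin) -!EFinM -EFinB mulrBl mul1r.
by rewrite -(fineK fin) -EFinM ltry.
Qed.

End farey_measure.

(** * Invariant sets of the Farey map *)

Section farey_ergodic.
Variables (R : realType) (F : finFieldType).
Local Notation q := (#|F|%:R : R).
Variable mu : {measure set (laurent F) -> \bar R}.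
Hypothesis mu_shift :
  forall (a : laurent F) (D : set (laurent F)), measurable D -> mu [set a + f | f in D] = mu D.
Hypothesis mu_unit : mu (lball 0 1) = 1%E.
Variable h : laurent F.
Hypothesis hS : sphere (-1) h.
Variable D : set (laurent F).
Hypothesis mD : measurable D.
Hypothesis D_inv : lball 0 1 `&` farey h @^-1` D = D.
Implicit Types (a f g : laurent F) (r n : int) (E : set (laurent F)).

Let q0 : q != 0. Proof. by rewrite gt_eqF// field_card_gt0. Qed.

(* The orbit of a nonzero [f] first reaches the open unit ball from the unit
   sphere at the Gauss map image [lfrac f^-1]. *)
Lemma farey_invariant_gauss f : f != 0 -> small 1 f -> D f <-> D (lfrac f^-1).
Proof.
have DE g : small 1 g -> D g <-> D (farey h g).
  move=> g1; split=> [|Dg]; first by rewrite -{1}D_inv => -[].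
  by rewrite -D_inv; split=> //; exact/lball0E.
move=> /sphere_ex[n fn] f1; have n1 : n < 1 by rewrite -(sphere_small 1 fn).
(* Induction on -n: each application of the map raises the degree of f by one until it is 0. *)
have [k nk] : exists k : nat, n = - k%:Z by exists `|n|%N; lia.
elim: k n f fn f1 {n1} nk => [|k IH] n f fn f1 nk; rewrite DE//.
  have gn : small 1 f^-1 by rewrite (sphere_small 1 (sphereV fn)); lia.
  by rewrite farey_deg0 ?fstep_lfrac//; move: fn; rewrite nk.
have fn' : sphere (- n - 1) (fstep h f^-1).
  by apply: fstep_sphere (sphereV fn) => //; lia.
have gn := sphereV fn'.
rewrite farey_lt//; last by rewrite (sphere_small 0 fn); lia.
rewrite (IH _ _ gn) ?invrK ?lfrac_fstep//; last by lia.
by rewrite (sphere_small 1 gn); lia.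
Qed.

Let A : set (laurent F) := @lfrac F @^-1` D.
Let mA : measurable A.
Proof. exact: measurable_preimage_laurent (@measurable_lfrac F) mD. Qed.
(** The open unit ball has measure 1/q, so k is the proportion of [A] in it. *)
Let k : R := q * fine (mu (A `&` lball 0 0)).

(** Inside the closed unit ball [farey_invariant_gauss] makes D the inverse image of [A] under
    inversion, and [haar_linv] at -n applies. *)
Lemma invariant_sphere n E : n <= 0 -> measurable E ->
  mu (D `&` (GRing.inv @^-1` E `&` sphere n)) =
  ((q ^ (n *+ 2))%:E * mu (A `&` (E `&` sphere (- n))))%E.
Proof.
move=> n0 mE; have -> : D `&` (GRing.inv @^-1` E `&` sphere n) =
    GRing.inv @^-1` (A `&` E) `&` sphere n.
  apply/seteqP; split=> f.
    move=> [Df [Ef fn]]; split=> //; split=> //.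
    apply/(farey_invariant_gauss (sphere_neq0 fn)) => //.
    by apply/(sphere_small 1 fn); lia.
  move=> [[Af Ef] fn]; split=> //.
  apply/(farey_invariant_gauss (sphere_neq0 fn)) => //.
  by apply/(sphere_small 1 fn); lia.
have := haar_linv mu_shift mu_unit (- n) (measurableI _ _ mA mE).
by rewrite mulNrn !opprK setIA.
Qed.

Lemma gauss_invariantE E : E `<=` lball 0 0 -> A `&` E = D `&` E.
Proof.
move=> EL; apply/seteqP; split=> f [Df Ef]; split=> //; move: Df;
  by rewrite /A /preimage /= lfrac_id//; apply/lball0E/EL.
Qed.

Lemma gauss_sphere n : mu (A `&` lball 0 (n + 1)) =
  (mu (A `&` lball 0%R n) + mu (A `&` sphere n))%E.
Proof.
rewrite sphere_lballD -measureU; first last.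
- by apply/seteqP; split=> // f [[_ fn] [_ [_]]].
- apply: measurableI => //; apply: measurableD; exact: measurable_lball.
- by apply: measurableI => //; exact: measurable_lball.
congr (mu _); rewrite -setIUr; congr (_ `&` _).
by apply/esym/setDUK; apply: lball_le; lia.
Qed.

(** Adding a polynomial does not change the fractional part, so [A] is periodic. *)
Lemma gauss_shift a r : r <= 0 -> mu (A `&` lball a r) = mu (A `&` lball (lfrac a) r).
Proof.
move=> r0; rewrite -[RHS](mu_shift (lpoly_part a)); last first.
  by apply: measurableI => //; exact: measurable_lball.
congr (mu _).
have aE : lpoly_part a + lfrac a = a by rewrite addrC subrK.
have lfracD f : lfrac (lpoly_part a + f) = lfrac f.
  by apply: laurentP => m; rewrite !lfracE lcoefD lpoly_partE; case: (0 <= m); rewrite ?add0r.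
have := lball_shift (lpoly_part a) (lfrac a) r; rewrite aE => ->.
apply/seteqP; split=> [f [Af [g ga gf]]|_ [f [Af fa] <-]].
  by exists g => //; split=> //; move: Af; rewrite /A /preimage /= -gf lfracD.
by split; [rewrite /A /preimage /= lfracD|exists f].
Qed.

(** At radius 0 periodicity moves every ball to the open unit ball; larger balls split into q balls
    of the previous radius. *)
Lemma gauss_lball_ge0 (r : nat) a : mu (A `&` lball a r) = (k * q ^ (r%:Z - 1))%:E.
Proof.
elim: r a => [|r IH] a.
  rewrite gauss_shift// -[in LHS](fineK (haar_lball_fin mu_shift mu_unit _ _ mA)).
  have -> : lball (lfrac a) 0 = lball 0 0.
    by rewrite -(@lballE _ 0)//; apply/lball0E; exact: lfrac_small.
  by rewrite /k mulrAC sub0r exprN1 divff// mul1r.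
rewrite setIC -[LHS]/(mrestr mu mA (lball a r.+1)).
have -> : r.+1%:Z = r%:Z + 1 by lia.
rewrite (lball_split_measure (v := (k * q ^ (r%:Z - 1))%:E)) => [|b]; last first.
  by rewrite -[LHS]/(mu (_ `&` _)) setIC IH.
have -> : r%:Z + 1 - 1 = 1 + (r%:Z - 1) by lia.
by rewrite -EFinM mulrCA [in RHS]expfzDr// expr1z.
Qed.

(** The induction descends on the radius: a ball of negative radius is compared, through inversion,
    with larger sets already treated. *)
Lemma gauss_lball a r : mu (A `&` lball a r) = (k * q ^ (r - 1))%:E.
Proof.
suff key (n : nat) s b : - n%:Z <= s -> mu (A `&` lball b s) = (k * q ^ (s - 1))%:E.
  by apply: (key `|r|%N); lia.
elim: n s b => [|n IH] s b.
  move=> s0; have -> : s = `|s|%N%:Z by lia.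
  exact: gauss_lball_ge0.
move=> ns; have [s0|s0] := leP 0 s.
  have -> : s = `|s|%N%:Z by lia.
  exact: gauss_lball_ge0.
rewrite gauss_shift//; last by lia.
have b0 := @lfrac_small _ b; move: (lfrac b) b0 => {}b b0.
(* A ball around 0 is not inverted to a ball. It is the ball of radius s + 1 minus the sphere of
   degree s, and inversion carries that sphere to degree -s > 0. *)
have [bs|bs] := pselect (small s b).
  have -> : lball b s = lball 0 s by rewrite -(@lballE _ 0)//; apply/lball0E.
  have val t : 0 <= t -> mu (A `&` lball 0 t) = (k * q ^ (t - 1))%:E.
    move=> t0; have -> : t = `|t|%N%:Z by lia.
    exact: gauss_lball_ge0.
  have := gauss_sphere (- s).
  rewrite (val (- s)) ?(val (- s + 1)); try lia.
  have := gauss_sphere s; rewrite IH; last by lia.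
  rewrite [A `&` sphere s]gauss_invariantE; last first.
    by move=> f fs; apply/lball0E/(sphere_small 0 fs).
  have := invariant_sphere (ltW s0) measurableT.
  rewrite preimage_setT !setTI => ->.
  (* Infinite values are excluded, since each term belongs to a sum known to be finite. *)
  case: (mu (A `&` sphere (- s))) => // y; rewrite -!EFinM.
  case: (mu (A `&` lball 0%R s)) => // x.
  rewrite -!EFinD => -[e1] [e2]; congr EFin.
  have -> : x = k * q ^ (s + 1 - 1) - q ^ (s *+ 2) * y by rewrite e1 addrK.
  have -> : y = k * q ^ (- s + 1 - 1) - k * q ^ (- s - 1) by rewrite e2 addrAC subrr add0r.
  move: k => K; rewrite mulrBr !(mulrCA _ K) -!expfzDr// -!mulrBr; congr (_ * _).
  have -> : s *+ 2 + (- s + 1 - 1) = s by lia.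
  have -> : s *+ 2 + (- s - 1) = s - 1 by lia.
  by rewrite addrK opprB addrC subrK.
have bn0 : b != 0 by apply: contra_notN bs => /eqP ->.
have [m bm] := sphere_ex bn0.
have sm : s <= m by move: bs; rewrite (sphere_small s bm); lia.
have m0 : m < 0 by move: b0; rewrite (sphere_small 0 bm); lia.
have bS : lball b s `<=` sphere m by move=> f fb; exact: lball_sphere sm fb bm.
(* A ball off 0 lies in a sphere of degree m < 0; its inverse has radius s - 2m >= s + 2, within the
   induction hypothesis. *)
have -> : A `&` lball b s = D `&` (GRing.inv @^-1` lball b^-1 (s - m *+ 2) `&` sphere m).
  rewrite gauss_invariantE; last by move=> f /bS fm; apply/lball0E/(sphere_small 0 fm).
  congr (_ `&` _); apply/seteqP; split=> f.
    by move=> fb; split; [exact/(lballV _ bm sm)|exact: bS].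
  by move=> [fb _]; exact/(lballV _ bm sm).
rewrite invariant_sphere//; [|lia|exact: measurable_lball].
rewrite [_ `&` sphere (- m)](_ : _ = lball b^-1 (s - m *+ 2)); last first.
  by apply/setIidPl => f fb; apply: (lball_sphere _ fb (sphereV bm)); lia.
rewrite IH; last by lia.
rewrite -EFinM mulrCA -expfzDr//; congr (_ * _ ^ _)%:E; lia.
Qed.

Lemma gauss_independent E : measurable E -> mu (A `&` E) = (k%:E * mu E)%E.
Proof.
move=> mE; have k0 : 0 <= k.
  by rewrite mulr_ge0 ?fine_ge0 ?measure_ge0// ltW// field_card_gt0.
rewrite setIC -[LHS]/(mrestr mu mA E) -[RHS]/(mscale (NngNum k0) mu E).
have ball a r : mu (lball a r `&` A) = (k%:E * mu (lball a r))%E.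
  by rewrite setIC gauss_lball haar_lball.
apply: lball_measure_unique => // r.
by rewrite [X in (X < _)%E]ball haar_lball// -EFinM ltry.
Qed.

Lemma invariant_lball : mu (D `&` lball 0 0) = (k * q^-1)%:E.
Proof. by rewrite -gauss_invariantE// gauss_lball sub0r exprN1. Qed.

(** [A] and D agree on the open unit ball, so independence from the trace of D there reads k/q = k
    (k/q). *)
Lemma gauss01 : k = 0 \/ k = 1.
Proof.
have mDL : measurable (D `&` lball 0 0) by apply: measurableI => //; exact: measurable_lball.
have := gauss_independent mDL.
rewrite gauss_invariantE; last by move=> f [].
rewrite setIA setIid invariant_lball -EFinM; move: k => K -[].
rewrite mulrA => /(mulIf (invr_neq0 q0)) /eqP.
rewrite -[X in X == _]mulr1 -subr_eq0 -mulrBr mulf_eq0 => /orP[/eqP|]; first by left.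
by rewrite subr_eq0 => /eqP; right.
Qed.

(** Inversion at degree 0 exchanges D with [A] on the unit sphere, so D has proportion k there
    too. *)
Lemma invariant_deg0 : mu (D `&` sphere 0) = (k * (1 - q^-1))%:E.
Proof.
have := invariant_sphere (lexx 0) measurableT.
rewrite preimage_setT !setTI mul0rn expr0z mul1e => ->.
rewrite (gauss_independent (@measurable_sphere F 0)) haar_sphere//.
Qed.

End farey_ergodic.

(** * The domains of the statement as balls and spheres *)

Section domains.
Variables (R : realType) (F : finFieldType).

Lemma int_ring_lball : int_ring R F = lball 0 1.
Proof.
rewrite int_ringE; apply/seteqP; split=> f; rewrite lball0E /=.
  by move=> /ldeg_le f0 m m1; apply: f0; lia.
by move=> f1; apply/ldeg_le => m m0; apply: f1; lia.
Qed.

Lemma max_ideal_lball : max_ideal R F = lball 0 0.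
Proof.
by rewrite max_idealE; apply/seteqP; split=> f; rewrite lball0E /= ldeg_ltP.
Qed.

Lemma deg0_set_sphere : deg0_set R F = sphere 0.
Proof.
rewrite /deg0_set int_ring_lball; apply/seteqP; split=> f; rewrite /= -sphere_ldeg.
  by case.
by move=> f0; split=> //; apply/lball0E; case: f0.
Qed.

End domains.

(** * Total mass, invariance and ergodicity *)

Theorem theorem2 (R : realType) (F : finFieldType)
    (mu : {measure set (laurent F) -> \bar R}) (h : laurent F) :
  haar_measure mu -> mu (int_ring R F) = 1%E ->
  max_ideal R F h -> ldeg h = (-1)%:E ->
  [/\ mu_A mu (int_ring R F) = 1%E,
      invariant_measure_on (int_ring R F) (farey h) (mu_A mu) &
      ergodic_on (int_ring R F) (farey h) (mu_A mu)].
Proof.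
have q_gt1 : (1 : R) < #|F|%:R by rewrite ltr1n card_finNzRing_gt1.
have q0 : #|F|%:R != 0 :> R by rewrite gt_eqF// field_card_gt0.
have q1 : 2 * #|F|%:R - 1 != 0 :> R by lra.
move=> [mu_shift _ _]; rewrite int_ring_lball => mu_unit _ /sphere_ldeg hS.
have mO : measurable (lball 0 1 : set (laurent F)) by exact: measurable_lball.
have mL : measurable (lball 0 0 : set (laurent F)) by exact: measurable_lball.
have mS : measurable (@sphere F 0) by exact: measurable_sphere.
have LO : lball 0 0 `<=` (lball 0 1 : set (laurent F)) by apply: lball_le.
have SO : @sphere F 0 `<=` lball 0 1 by move=> f [_ /lball0E].
have OE : lball 0 1 = lball 0 0 `|` @sphere F 0.
  by rewrite sphere_lballD add0r setDUK.
have mu_AE D : mu_A mu D =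
    ((#|F|%:R ^+ 2 / (2 * #|F|%:R - 1))%:E * mu (D `&` lball 0%R 0) +
     (#|F|%:R / (2 * #|F|%:R - 1))%:E * mu (D `&` sphere 0))%E.
  by rewrite /mu_A max_ideal_lball deg0_set_sphere.
have total : mu_A mu (lball 0 1) = 1%E.
  rewrite mu_AE (setIidr LO) (setIidr SO) haar_lball// haar_sphere//.
  rewrite expr0z sub0r exprN1 -!EFinM -EFinD.
  by apply: (congr1 EFin); field; rewrite q0 q1.
have psiE f : lball 0 0 f -> farey h f = (fstep h f^-1)^-1.
  by move=> /lball0E; exact: farey_lt.
split=> //.
- split.
  + move=> f; rewrite OE => -[fL|fS].
      have [->|/sphere_ex[n fn]] := eqVneq f 0.
        by left; rewrite /farey eqxx; apply/lball0E.
      have n0 : n < 0 by move/lball0E : fL; rewrite (sphere_small 0 fn).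
      rewrite -OE psiE//; apply/lball0E.
      (* The image has degree n + 1, which is at most 0. *)
      have gn := sphereV (fstep_sphere hS (_ : 0 < - n) (sphereV fn)).
      by rewrite (sphere_small 1 (gn _)); lia.
    by left; rewrite farey_deg0//; apply/lball0E/fstep_small0 => //; case: (sphereV fS).
  + rewrite OE; apply/measurable_funU => //; split.
      have mpsi := measurable_funTS (D := lball 0 0) (measurable_farey_lt hS).
      by apply: eq_measurable_fun mpsi => f /set_mem /psiE.
    have mpsi := measurable_funTS (D := sphere 0) (measurable_farey_deg0 hS).
    by apply: eq_measurable_fun mpsi => f /set_mem fS; rewrite farey_deg0.
  + move=> D mD DO; rewrite [LHS]mu_AE [RHS]mu_AE.
    have -> : lball 0 1 `&` farey h @^-1` D `&` lball 0 0 =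
        (fun f => (fstep h f^-1)^-1) @^-1` D `&` lball 0 0.
      apply/seteqP; split=> f [Df fL]; split=> //.
        by case: Df => _; rewrite /preimage /= psiE.
      by split; [exact: LO|rewrite /preimage /= psiE].
    have -> : lball 0 1 `&` farey h @^-1` D `&` sphere 0 =
        (fun f => fstep h f^-1) @^-1` D `&` sphere 0.
      apply/seteqP; split=> f [Df fL]; split=> //.
        by case: Df => _; rewrite /preimage /= farey_deg0.
      by split; [exact: SO|rewrite /preimage /= farey_deg0].
    rewrite (farey_lt_measure mu_shift mu_unit hS mD).
    rewrite (farey_deg0_measure mu_shift mu_unit hS mD).
    have -> : mu (D `&` lball 0 1) = (mu (D `&` lball 0%R 0) + mu (D `&` sphere 0))%E.
      rewrite OE setIUr measureU//; [exact: measurableI|exact: measurableI|].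
      rewrite sphere_lballD; apply/seteqP.
      by split=> // f [[_ fL] [_ [_]]].
    have finL := haar_lball_fin mu_shift mu_unit 0 0 mD.
    have finS : mu (D `&` sphere 0) \is a fin_num.
      have := haar_lball_fin mu_shift mu_unit 0 1 (measurableI _ _ mD mS).
      by rewrite -setIA (setIidl SO).
    (* With x and y the measures of D in the open ball and on the unit sphere, the claim is q^2 (x +
       y)/q + q (q - 1) x = q^2 x + q y, up to the factor 1/(2q - 1). *)
    rewrite -(fineK finL) -(fineK finS) -!(EFinM, EFinD); congr EFin.
    by field; rewrite ?q0 ?q1.
- move=> D mD DO D_inv.
  (* D has proportion k both in the open ball and on the unit sphere, and [mu_A] has total mass 1,
     so its value on D is k. *)
  have muD : mu_A mu D = (#|F|%:R * fine (mu (@lfrac F @^-1` D `&` lball 0%R 0)))%:E.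
    rewrite mu_AE (invariant_lball mu_shift mu_unit hS mD D_inv).
    rewrite (invariant_deg0 mu_shift mu_unit hS mD D_inv).
    rewrite -!EFinM -EFinD; congr EFin.
    by field; rewrite ?q0 ?q1.
  have [k0|k1] := gauss01 mu_shift mu_unit hS mD D_inv.
    by left; rewrite [LHS]muD k0.
  right; rewrite measureD//=.
    by rewrite (setIidr DO) [X in (X - _)%E]total [X in (_ - X)%E]muD k1 subee.
  by rewrite [X in (X < _)%E]total ltry.
Qed.
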